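(* (1) Let $F_2$ be the free group with basis $\{a,b\}$, and consider the power series in two variables $$\Delta_{F_2}(z_1,z_2)=\sum_{g\in F_2} z_1^{|g|_{a}+|g|_{a^{-1}}}\,z_2^{|g|_{b}+|g|_{b^{-1}}},$$ where for $g\in F_2$, $|g|_{x}$ denotes the number of occurrences of the letter $x$ in the freely reduced word over $\{a,a^{-1},b,b^{-1}\}$ representing $g$. Then for every $\mathbf r=(p,q)\in M_2$ the indicatrice of growth of $\Delta_{F_2}$ is $$\psi_{F_2}(\mathbf r)=\mathbf H(\mathbf r)+p\log\!\left(2q-p+2\sqrt{p^2-pq+q^2}\right)+q\log\!\left(2p-q+2\sqrt{p^2-pq+q^2}\right),$$ where $\mathbf H(\mathbf r)=-p\log p-q\log q$ is the Shannon entropy (with $0\log 0=0$). (2) Let $L_{Fib}\subset\{a,b\}^*$ be the Fibonacci language, i.e. the set of all finite words over $\{a,b\}$ not containing $bb$ as a subword, and let $\Gamma_{Fib}(z_1,z_2)=\sum_{w\in L_{Fib}} z_1^{|w|_a}z_2^{|w|_b}$ (which equals $\frac{1+z_2}{1-z_1-z_1z_2}$). Then for $\mathbf r=(p,q)=(p,1-p)$ with $0<p<1$, the indicatrice of growth of $\Gamma_{Fib}$ is $$\psi_{Fib}(\mathbf r)=p\log\!\left(\frac{p}{p-q}\right)+q\log\!\left(\frac{p-q}{q}\right)\ \text{ if } p\ge \tfrac12,\qquad \psi_{Fib}(\mathbf r)=-\infty\ \text{ if } p<\tfrac12 .$$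
   Context: $M_d=\{\mathbf r\in\mathbb R_{\ge 0}^d:\ \|\mathbf r\|=\sum_i r_i=1\}$, where $\|\cdot\|$ is the $\ell^1$ norm on $\mathbb R^d$. For a power series $\Gamma(\mathbf z)=\sum_{\mathbf i\in\mathbb N^d} f_{\mathbf i}\mathbf z^{\mathbf i}$ with nonnegative coefficients, the indicatrice of growth is defined as follows. For an open cone $C\subset\mathbb R^d$ put $\tau_C=\limsup_{R\to\infty}\frac1R\log\Big(\sum_{\mathbf i\in C\cap\mathbb N^d,\ R\le\|\mathbf i\|\le R+1} f_{\mathbf i}\Big)$ (with $\log 0=-\infty$), and for $\mathbf r\ne 0$ put $\psi(\mathbf r)=\|\mathbf r\|\inf_{C\ni\mathbf r}\tau_C$, the infimum over open cones containing $\mathbf r$; also $\psi(\mathbf 0)=0$. $\psi_{F_2}$ and $\psi_{Fib}$ denote this function for $\Delta_{F_2}$ and $\Gamma_{Fib}$ respectively. *)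

(* Defs.v *)
From HB Require Import structures.
From mathcomp Require Import all_boot all_order all_algebra.
From mathcomp Require Import all_classical all_reals all_analysis.
Set Implicit Arguments. Unset Strict Implicit. Unset Printing Implicit Defensive.
Import Order.TTheory GRing.Theory Num.Theory.
Import numFieldNormedType.Exports.
Local Open Scope classical_set_scope.
Local Open Scope ring_scope.

Section Indicatrice.
Variable R : realType.

Definition open_cone (C : set (R * R)) : Prop :=
  open C /\ forall x, C x -> forall l : R, 0 < l -> C (l * x.1, l * x.2).

(* sum of the coefficients f_(i,j) over lattice points (i,j) in C
   with Rr <= i + j <= Rr + 1 (all such points satisfy i,j < N) *)
Definition shell_sum (f : nat -> nat -> R) (C : set (R * R)) (Rr : R) : R :=
  let N := (Num.truncn (Rr + 1)).+1 in
  \sum_(i < N) \sum_(j < N)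
     (if `[< C (i%:R, j%:R) /\ Rr <= (i + j)%:R <= Rr + 1 >] then f i j else 0).

Definition shell_rate (f : nat -> nat -> R) (C : set (R * R)) (Rr : R) : \bar R :=
  if shell_sum f C Rr == 0 then -oo%E else (ln (shell_sum f C Rr) / Rr)%:E.

Definition tau (f : nat -> nat -> R) (C : set (R * R)) : \bar R :=
  limf_esup (shell_rate f C) (pinfty_nbhs R).

Definition indicatrice (f : nat -> nat -> R) (r : R * R) : \bar R :=
  if r == (0, 0) then 0%E else
  ((`|r.1| + `|r.2|)%:E *
     ereal_inf [set tau f C | C in [set C | open_cone C /\ C r]])%E.

Definition plogp (p : R) : R := if p == 0 then 0 else p * ln p.

Definition entropy (r : R * R) : R := - plogp r.1 - plogp r.2.

End Indicatrice.

(* ---------- free group F_2 : elements are represented by their (unique)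
   freely reduced words over {a, a^-1, b, b^-1}.  A letter is a pair
   (g, e) : bool * bool with g = false for a, g = true for b,
   e = true for an inverse letter. *)
Definition letter := (bool * bool)%type.

Definition reduced (w : seq letter) : bool :=
  sorted (fun u v : letter => ~~ ((u.1 == v.1) && (u.2 != v.2))) w.

Definition count_ab (w : seq letter) : nat := count (fun x : letter => ~~ x.1) w.
Definition count_bb (w : seq letter) : nat := count (fun x : letter => x.1) w.

(* coefficient of z1^i z2^j in Delta_F2 : number of g in F_2 with
   |g|_a + |g|_{a^-1} = i and |g|_b + |g|_{b^-1} = j
   (such reduced words have length i + j) *)
Definition coefF2 (R : realType) (i j : nat) : R :=
  #|[set t : (i + j).-tuple letter |
       [&& reduced t, count_ab t == i & count_bb t == j]]|%:R.

(* ---------- Fibonacci language: words over {a,b} (a = false, b = true)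
   with no factor bb *)
Definition fib_word (w : seq bool) : bool := sorted (fun u v : bool => ~~ (u && v)) w.

Definition coefFib (R : realType) (i j : nat) : R :=
  #|[set t : (i + j).-tuple bool |
       [&& fib_word t, count negb t == i & count id t == j]]|%:R.

(* Main.v *)
Require Import Defs.
From HB Require Import structures.
From mathcomp Require Import all_boot all_order all_algebra.
From mathcomp Require Import all_classical all_reals all_analysis.
From mathcomp Require Import ring lra zify.
Import Order.TTheory GRing.Theory Num.Theory.
Import numFieldNormedType.Exports.
Local Open Scope ring_scope.

(** Words over a finite alphabet split into two letter types are counted by a
    two-state transfer matrix [[1, m], [m, c]] ([m = 2, c = 1] for reduced words
    of F_2, [m = 1, c = 0] for the Fibonacci language).  Giving the two letter
    types the weights [x = t / (t + m)] and [y = 1 / (m t + c)], [t > 0], makes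
    the Perron eigenvalue equal to 1, so the total weight of the words of length
    [n] stays between two positive constants.

    Upper bound: [f i j * x ^ i * y ^ j] is bounded, so [psi(p, q)] is at most
    [p ln (1 + m / t) + q ln (m t + c)] for every [t > 0].

    Lower bound: at the direction proportional to [(t (t + m), m t + c)], where
    [t] is the minimizer, words of any other letter frequency have exponentially
    small weight (compare with a neighbouring parameter [t1]), so the words in a
    small cone carry a positive proportion of the weight and their number grows
    at the above rate.

    The directions not reached by any [t > 0] are limits [t -> 0] or
    [t -> oo]. *)

(** * Weighted word sums and the transfer operator *)

Lemma big_tuple_cons (V : nmodType) (A : finType) (n : nat)
    (Q : pred (seq A)) (F : seq A -> V) :
  \sum_(w : n.+1.-tuple A | Q w) F w =
  \sum_(v : A) \sum_(w : n.-tuple A | Q (v :: w)) F (v :: w).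
Proof.
rewrite pair_big_dep /=.
rewrite (reindex (fun p : A * n.-tuple A => [tuple of p.1 :: p.2])) //=.
exists (fun w => (thead w, [tuple of behead w])) => [[v w]|w] _ /=.
  by congr pair; apply/val_inj.
by rewrite -tuple_eta.
Qed.

Section Words.
Variables (R : realType) (A : finType) (ok : rel A) (b : pred A).

Definition word_coef (i j : nat) : R :=
  #|[set t : (i + j).-tuple A |
       [&& sorted ok t, count (fun x => ~~ b x) t == i & count b t == j]]|%:R.

Section Weights.
Variables x y : R.

Definition letter_weight (v : A) : R := if b v then y else x.

Lemma prod_letter_weight (w : seq A) :
  \prod_(v <- w) letter_weight v = x ^+ count (fun x => ~~ b x) w * y ^+ count b w.
Proof.
elim: w => [|v w IH]; first by rewrite big_nil mulr1.
rewrite big_cons IH /= /letter_weight; case: (b v) => /=; rewrite ?add0n ?add1n exprS.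
  by rewrite mulrCA.
by rewrite mulrA.
Qed.

(** Grouping the words by their number of letters outside [b] passes from words to coefficients. *)
Lemma sum_sorted_weight (n : nat) :
  \sum_(w : n.-tuple A | sorted ok w) \prod_(v <- w) letter_weight v =
  \sum_(i < n.+1) word_coef i (n - i) * (x ^+ i * y ^+ (n - i)).
Proof.
pose c (w : n.-tuple A) : 'I_n.+1 := inord (count (fun x => ~~ b x) w).
have cE (w : n.-tuple A) : c w = count (fun x => ~~ b x) w :> nat.
  by rewrite inordK // ltnS -[leqRHS](size_tuple w) count_size.
have cntD (w : n.-tuple A) : (count (fun x => ~~ b x) w + count b w = n)%N.
  by rewrite addnC -[RHS](size_tuple w) -(count_predC b).
have coefE i j : (i + j = n)%N -> word_coef i j =
    #|[set t : n.-tuple A | [&& sorted ok t,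
         count (fun x => ~~ b x) t == i & count b t == j]]|%:R by move=> <-.
rewrite (partition_big c xpredT) //=; apply: eq_bigr => i _.
have lein : (i <= n)%N by rewrite -ltnS.
rewrite (coefE i (n - i)%N) ?subnKC // mulr_natl -sumr_const.
rewrite big_mkcond [RHS]big_mkcond /=; apply: eq_bigr => w _.
rewrite inE -(inj_eq val_inj) /= cE.
have := cntD w; case: eqP => [Hi Hn|_ _]; last by rewrite andbF.
have cb : count b w = (n - i)%N by lia.
by rewrite cb eqxx !andbT prod_letter_weight Hi cb.
Qed.

Definition path_sum (n : nat) (u : A) : R :=
  \sum_(w : n.-tuple A | path ok u w) \prod_(v <- w) letter_weight v.

Lemma path_sum0 (u : A) : path_sum 0 u = 1.
Proof.
rewrite /path_sum (big_pred1 [tuple]) ?big_nil // => w.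
by rewrite (tuple0 w).
Qed.

Lemma path_sumS (n : nat) (u : A) :
  path_sum n.+1 u = \sum_(v | ok u v) letter_weight v * path_sum n v.
Proof.
rewrite /path_sum (@big_tuple_cons _ _ _ (path ok u)
  (fun w => \prod_(v <- w) letter_weight v)).
rewrite [RHS]big_mkcond; apply: eq_bigr => v _ /=.
case: (ok u v) => /=; last by rewrite big_pred0.
by rewrite big_distrr /=; apply: eq_bigr => w _; rewrite big_cons.
Qed.

Lemma sum_sorted_weightS (n : nat) :
  \sum_(w : n.+1.-tuple A | sorted ok w) \prod_(v <- w) letter_weight v =
  \sum_v letter_weight v * path_sum n v.
Proof.
rewrite (@big_tuple_cons _ _ _ (sorted ok) (fun w => \prod_(v <- w) letter_weight v)).
apply: eq_bigr => v _ /=.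
by rewrite big_distrr /=; apply: eq_bigr => w _; rewrite big_cons.
Qed.

(** The transfer operator is monotone, the weights being nonnegative, and fixes [h]; so the
    comparison of [h] with the constant 1 at length 0 persists by induction. *)
Lemma path_sum_harmonic (h : A -> R) (k K : R) : 0 <= x -> 0 <= y ->
  (forall u, \sum_(v | ok u v) letter_weight v * h v = h u) ->
  (forall u, k * h u <= 1 <= K * h u) ->
  forall n u, k * h u <= path_sum n u <= K * h u.
Proof.
move=> x0 y0 harm hk; elim=> [|n IH] u; first by rewrite path_sum0.
have w0 v : 0 <= letter_weight v by rewrite /letter_weight; case: (b v).
rewrite path_sumS -harm !big_distrr /=.
by apply/andP; split; apply: ler_sum => v _; rewrite mulrCA ler_wpM2l //;
  case/andP: (IH v).
Qed.

End Weights.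

(* These weights turn [t + m] (after a letter outside [b]) and [m * t + c] (after
   a letter of [b]) into a positive eigenvector of eigenvalue 1. *)
Lemma word_coef_bounds (m c t : R) (v0 : A) : 0 < m -> 0 <= c -> 0 < t ->
  (forall u, \sum_(v | ok u v) (if b v then 1 else t) =
             if b u then m * t + c else t + m) ->
  exists k K : R, 0 < k /\ forall n,
    k <= \sum_(i < n.+1) word_coef i (n - i) *
           ((t / (t + m)) ^+ i * (m * t + c)^-1 ^+ (n - i)) <= K.
Proof.
move=> m0 c0 t0 harm.
have ha0 : 0 < t + m by rewrite addr_gt0.
have hb0 : 0 < m * t + c by rewrite ltr_wpDr // mulr_gt0.
pose x := t / (t + m); pose y := (m * t + c)^-1.
pose h u := if b u then m * t + c else t + m.
have h0 u : 0 < h u by rewrite /h; case: (b u).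
have whE v : letter_weight x y v * h v = if b v then 1 else t.
  rewrite /letter_weight /h; case: (b v); first by rewrite mulVf // gt_eqF.
  by rewrite divfK // gt_eqF.
have harm' u : \sum_(v | ok u v) letter_weight x y v * h v = h u.
  by rewrite -[RHS]harm; apply: eq_bigr => v _; rewrite whE.
(* [h] takes only two values: the denominator of [k] dominates both, and [K] contains the reciprocal
   of each. *)
pose k := (h v0 + (t + m) + (m * t + c))^-1.
pose K := (t + m)^-1 + (m * t + c)^-1.
have kK u : k * h u <= 1 <= K * h u.
  apply/andP; split.
    have D0 : 0 < h v0 + (t + m) + (m * t + c) by rewrite addr_gt0 // addr_gt0.
    rewrite ler_pdivrMl // mulr1.
    by have := h0 v0; rewrite [X in _ <= X + _ + _]/h /h; case: (b u); case: (b v0); lra.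
  rewrite /K mulrDl /h; case: (b u).
    rewrite [X in _ + X]mulVf ?gt_eqF // lerDr mulr_ge0 ?invr_ge0 //; exact: ltW.
  rewrite mulVf ?gt_eqF // lerDl mulr_ge0 ?invr_ge0 //; exact: ltW.
have x0 : 0 <= x by rewrite divr_ge0 // ltW.
have y0 : 0 <= y by rewrite invr_ge0 // ltW.
have bnd := @path_sum_harmonic x y h k K x0 y0 harm' kK.
pose s := \sum_v (if b v then 1 else t).
have s0 : 0 < s.
  rewrite /s (bigD1 v0) //= ltr_wpDr //.
    by apply: sumr_ge0 => v _; case: (b v) => //; exact: ltW.
  by case: (b v0).
have k0 : 0 < k by rewrite invr_gt0 addr_gt0 // addr_gt0.
(* The 1 in both bounds covers the empty word; the words of length [n + 1] have total weight between
   [k * s] and [K * s]. *)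
exists (Num.min 1 (k * s)), (1 + K * s); split.
  by rewrite lt_min ltr01 mulr_gt0.
have K0 : 0 <= K by rewrite addr_ge0 // invr_ge0 ltW.
case=> [|n]; rewrite -sum_sorted_weight.
  rewrite (big_pred1 [tuple]) ?big_nil; last by move=> w; rewrite (tuple0 w).
  by rewrite ge_min lexx lerDl mulr_ge0 // ltW.
rewrite sum_sorted_weightS.
have w0 v : 0 <= letter_weight x y v by rewrite /letter_weight; case: (b v).
have sE : s = \sum_v letter_weight x y v * h v by apply: eq_bigr => v _; rewrite whE.
apply/andP; split.
  rewrite ge_min; apply/orP; right; rewrite sE big_distrr /=.
  by apply: ler_sum => v _; rewrite mulrCA ler_wpM2l //; case/andP: (bnd n v).
apply: ler_wpDl => //; rewrite sE big_distrr /=.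
by apply: ler_sum => v _; rewrite mulrCA ler_wpM2l //; case/andP: (bnd n v).
Qed.

End Words.

(** * Growth rates of shell sums *)

Section GrowthRate.
Variables (R : realType) (f : nat -> nat -> R).
Hypothesis f_ge0 : forall i j, 0 <= f i j.

Lemma tau_le (C : set (R * R)) (M : R) (l : \bar R) :
  (forall r, M < r -> (shell_rate f C r <= l)%E) -> (tau f C <= l)%E.
Proof.
move=> H; apply: ge_ereal_inf.
exists (ereal_sup (shell_rate f C @` [set r | M < r]%classic)).
  by exists [set r | M < r]%classic => //; exists M; split=> //; exact: num_real.
by apply: ge_ereal_sup => _ [r Mr <-]; exact: H.
Qed.

Lemma tau_ge (C : set (R * R)) (l : \bar R) :
  (forall M, exists2 r, M < r & (l <= shell_rate f C r)%E) -> (l <= tau f C)%E.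
Proof.
move=> H; apply: le_ereal_inf_tmp => _ [V [M [_ MV]] <-].
have [r Mr lr] := H M.
by apply: ereal_sup_ge; exists (shell_rate f C r) => //; exists r => //; exact: MV.
Qed.

Lemma shell_sum_ge0 (C : set (R * R)) (r : R) : 0 <= shell_sum f C r.
Proof. by apply: sumr_ge0 => i _; apply: sumr_ge0 => j _; case: ifP. Qed.

(** A shell of radius [r] has quadratically many lattice points, each contributing at most a
    constant times [expR (l * r)]; the quadratic factor does not change the exponential rate. *)
Lemma tau_le_exp (C : set (R * R)) (K l : R) : 0 < K ->
  (forall i j, C (i%:R, j%:R) -> f i j <= K * expR ((i + j)%:R * l)) ->
  (tau f C <= l%:E)%E.
Proof.
move=> K0 fK; apply/lee_addgt0Pr => e e0.
(* The factor pays for [i + j] exceeding [r] by up to 1, whatever the sign of [l]. *)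
pose B := K * expR `|l|.
have B0 : 0 < B by rewrite mulr_gt0 ?expR_gt0.
(* For [r >= 1] the index box has at most [9 r^2] points; the cubic term [(e r)^3 / 6] of
   [expR (e * r)] absorbs [9 r^2 B] once [r > 54 B / e^3]. *)
apply: (@tau_le _ (1 + 54 * B / e ^+ 3)) => r Mr.
have e30 : 0 < e ^+ 3 by rewrite exprn_gt0.
have r1 : 1 <= r by apply: le_trans (ltW Mr); rewrite lerDl divr_ge0 ?mulr_ge0 ?ltW.
have r0 : 0 < r by apply: lt_le_trans r1.
rewrite /shell_rate; case: eqP => [_|/eqP s0]; first exact: leNye.
have {}s0 : 0 < shell_sum f C r by rewrite lt_neqAle eq_sym s0 shell_sum_ge0.
rewrite -EFinD lee_fin ler_pdivrMr // -[leRHS]expRK ler_ln ?posrE ?expR_gt0 //.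
set N := (Num.truncn (r + 1)).+1.
have NB : N%:R <= r + 2.
  have : (Num.truncn (r + 1))%:R <= r + 1 by rewrite truncn_le; lra.
  by rewrite /N -natr1; lra.
have term (i j : nat) : (if `[< C (i%:R, j%:R) /\ r <= (i + j)%:R <= r + 1 >]
    then f i j else 0) <= B * expR (l * r).
  case: ifPn => [/asboolP [Cij /andP[h1 h2]]|_]; last first.
    by rewrite mulr_ge0 ?expR_ge0 ?(ltW B0).
  apply: (le_trans (fK _ _ Cij)); rewrite /B -mulrA ler_pM2l // -expRD ler_expR.
  have -> : (i + j)%:R * l = ((i + j)%:R - r) * l + l * r by ring.
  rewrite lerD2r; apply: (le_trans (ler_norm _)); rewrite normrM.
  rewrite -[leRHS]mul1r ler_wpM2r // ger0_norm; lra.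
apply: (@le_trans _ _ (\sum_(i < N) \sum_(j < N) B * expR (l * r))).
  by apply: ler_sum => i _; apply: ler_sum => j _; exact: term.
rewrite !sumr_const !card_ord -mulrnA -mulr_natl natrM mulrDl expRD.
rewrite [X in _ <= X]mulrC mulrA ler_pM2r ?expR_gt0 //.
apply: (@le_trans _ _ (9 * r ^+ 2 * B)).
  rewrite ler_pM2r //; have N0 : (0 : R) <= N%:R by [].
  nra.
have er0 : 0 <= e * r by rewrite mulr_ge0 ?ltW.
apply: (le_trans _ (@expR_ge1Dxn _ (e * r) 2 er0)).
have : 54 * B < r * e ^+ 3.
  by rewrite -ltr_pdivrMr //; apply: le_lt_trans Mr; rewrite lerDr.
rewrite exprMn (_ : 3`! = 6)%N //.
set E3 := e ^+ 3 => BE.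
have : 54 * B * r ^+ 2 <= r * E3 * r ^+ 2 by rewrite ler_wpM2r ?sqr_ge0 ?ltW.
have -> : E3 * r ^+ 3 = r * E3 * r ^+ 2 by ring.
lra.
Qed.

Lemma shell_sum_ge_diag (C : set (R * R)) (n : nat) :
  \sum_(i < n.+1 | `[< C (i%:R, (n - i)%:R) >]) f i (n - i) <=
  shell_sum f C n%:R.
Proof.
(* At radius [n] the row index runs up to [n + 1]; this last row is split off and dropped. *)
rewrite /shell_sum natr1 natrK big_ord_recr /= big_mkcond /=.
apply: ler_wpDr.
  by apply: sumr_ge0 => j _; case: ifP.
apply: ler_sum => i _; case: ifPn => [/asboolP Ci|_]; last first.
  by apply: sumr_ge0 => j _; case: ifP.
have lein : (i <= n)%N by rewrite -ltnS.
have jlt : (n - i < n.+2)%N by lia.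
rewrite (bigD1 (Ordinal jlt)) //= ifT.
  by rewrite lerDl; apply: sumr_ge0 => j _; case: ifP.
apply/asboolP; split=> //; rewrite subnKC // lexx /= -natr1 lerDl //.
Qed.

Lemma expR_decay (K d k : R) : 0 < K -> 0 < d -> 0 < k ->
  exists M : R, forall n : nat, M < n%:R -> n.+1%:R * (K * expR (- (n%:R * d))) <= k.
Proof.
(* By [expR (n d) >= (n d)^2 / 2] and [n + 1 <= 2 n], the left side is at most [4 K / (n d^2)]. *)
move=> K0 d0 k0; exists (1 + 4 * K / (k * d ^+ 2)) => n nM.
have kd0 : 0 < k * d ^+ 2 by rewrite mulr_gt0 ?exprn_gt0.
have n1 : 1 < n%:R :> R.
  by apply: le_lt_trans nM; rewrite lerDl divr_ge0 ?mulr_ge0 ?ltW.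
have nd0 : 0 <= n%:R * d by rewrite mulr_ge0 // ltW.
rewrite expRN mulrA ler_pdivrMr ?expR_gt0 //.
have := @expR_ge1Dxn _ (n%:R * d) 1 nd0; rewrite (_ : 2`! = 2)%N // => E.
apply: (@le_trans _ _ (k * ((n%:R * d) ^+ 2 / 2))); last first.
  by rewrite ler_pM2l //; apply: le_trans E; rewrite lerDr.
have : 4 * K < n%:R * (k * d ^+ 2).
  by rewrite -ltr_pdivrMr //; apply: le_lt_trans nM; rewrite lerDr.
rewrite -[n.+1%:R]natr1 exprMn; move: (n%:R) n1 => z z1.
set D := d ^+ 2 => h.
have : 4 * K * z <= z * (k * D) * z by rewrite ler_wpM2r //; lra.
have -> : k * (z ^+ 2 * D / 2) = z * (k * D) * z / 2 by field.
have : K * 1 <= K * z by rewrite ler_pM2l // ltW.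
lra.
Qed.

End GrowthRate.

(** * Bounds on the indicatrice from a one-parameter family of weights *)

Section Family.
Variables (R : realType) (m c : R) (f : nat -> nat -> R).
Hypotheses (m_gt0 : 0 < m) (c_ge0 : 0 <= c).
Hypothesis f_ge0 : forall i j, 0 <= f i j.
Hypothesis f_bounds : forall t : R, 0 < t -> exists k K : R, 0 < k /\ forall n,
  k <= \sum_(i < n.+1) f i (n - i) *
         ((t / (t + m)) ^+ i * (m * t + c)^-1 ^+ (n - i)) <= K.

(** [ratea] and [rateb] are minus the logarithms of the weights of the two letter types. *)
Definition ratea (t : R) : R := ln (1 + m / t).
Definition rateb (t : R) : R := ln (m * t + c).

Lemma den_gt0 (t : R) : 0 < t -> 0 < m * t + c.
Proof. by move=> t0; rewrite ltr_wpDr // mulr_gt0. Qed.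

Lemma weight_expR (t : R) (i j : nat) : 0 < t ->
  (t / (t + m)) ^+ i * (m * t + c)^-1 ^+ j =
  expR (- (i%:R * ratea t + j%:R * rateb t)).
Proof.
move=> t0; rewrite opprD expRD !expRN !expRM_natl /ratea /rateb.
rewrite !lnK ?posrE ?den_gt0 //; last by rewrite addr_gt0 ?divr_gt0.
rewrite -!exprVn; congr (_ ^+ _ * _); field.
by rewrite !gt_eqF ?addr_gt0.
Qed.

(** A single coefficient is one nonnegative term of the bounded weighted sum of length [i + j]. *)
Lemma coef_le_expR (t : R) : 0 < t -> exists2 K : R, 0 < K & forall i j,
  f i j <= K * expR (i%:R * ratea t + j%:R * rateb t).
Proof.
move=> t0; have [k [K [k0 kK]]] := f_bounds t t0.
exists K; first by apply: lt_le_trans k0 _; have /andP[] := kK 0%N; exact: le_trans.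
move=> i j; have /andP[_] := kK (i + j)%N.
have iN : (i < (i + j).+1)%N by lia.
rewrite (bigD1 (Ordinal iN)) //= addKn weight_expR // => h.
rewrite -ler_pdivrMr ?expR_gt0 // -expRN; apply: le_trans h.
rewrite lerDl; apply: sumr_ge0 => l _.
by rewrite weight_expR // mulr_ge0 ?expR_ge0.
Qed.

(* With [L] the right-hand side, the half-plane
   [i * ratea t + j * rateb t < (L + e) * (i + j)] is an open cone on which
   [coef_le_expR] alone gives rate at most [L + e]. *)
Lemma inf_tau_le (t p q : R) : 0 < t -> p + q = 1 ->
  (ereal_inf [set tau f C | C in [set C | open_cone C /\ C (p, q)]]
   <= (p * ratea t + q * rateb t)%:E)%E.
Proof.
move=> t0 pq; have [K K0 fK] := coef_le_expR t t0.
set a := ratea t in fK *; set b := rateb t in fK *; set L := p * a + q * b.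
apply/lee_addgt0Pr => e e0; rewrite -EFinD.
pose g (x : R * R) := (L + e - a) * x.1 + (L + e - b) * x.2.
apply: ereal_inf_le; exists (tau f [set x | 0 < g x]%classic).
  exists [set x | 0 < g x]%classic => //; split; first split.
  - apply: (@open_comp _ _ g [set x | 0 < x]%classic); last exact: open_gt.
    move=> x _; rewrite /continuous_at /g; apply: cvgD.
      by apply: cvgM; [exact: cvg_cst | exact: cvg_fst].
    by apply: cvgM; [exact: cvg_cst | exact: cvg_snd].
  - move=> x; rewrite /= /g /= => gx l l0.
    have -> : (L + e - a) * (l * x.1) + (L + e - b) * (l * x.2) =
       l * ((L + e - a) * x.1 + (L + e - b) * x.2) by ring.
    exact: mulr_gt0.
  - rewrite /= /g /=; have -> : (L + e - a) * p + (L + e - b) * q =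
       (L + e) * (p + q) - L by rewrite /L; ring.
    by rewrite pq mulr1 addrAC subrr add0r.
apply: (@tau_le_exp _ f f_ge0 _ K (L + e) K0) => i j; rewrite /= /g /= => gij.
apply: (le_trans (fK i j)); rewrite ler_pM2l // ler_expR natrD; lra.
Qed.

(* Obtained from [coef_le_expR] at a parameter [t1] on the same side of [t] as
   [p'] is of [p0]: the derivative in [t] of [p' * ratea t + (1 - p') * rateb t]
   is nonzero unless [p' = p0]. *)
Lemma coef_weight_off_freq_le (t p' : R) : 0 < t -> 0 < p' < 1 ->
  let p0 := t * (t + m) / (t * (t + m) + (m * t + c)) in
  p' != p0 -> exists K d : R, [/\ 0 < K, 0 < d & forall i n, (i <= n)%N ->
    0 <= (p' - p0) * (i%:R - n%:R * p') ->
    f i (n - i) * expR (- (i%:R * ratea t + (n - i)%:R * rateb t))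
      <= K * expR (- (n%:R * d))].
Proof.
move=> t0 /andP[p'0 p'1] p0 p'p0.
have A0 : 0 < t + m by rewrite addr_gt0.
pose B := m * t + c; have B0 : 0 < B := den_gt0 t t0.
have q'0 : 0 < 1 - p' by rewrite subr_gt0.
(* [ts] equals [t] exactly when [p' = p0], and [t1] is the midpoint of [t] and [ts]. The half-step
   [h] has the sign of [p' - p0], as [s > 0]. *)
pose ts := p' * B / ((1 - p') * (t + m)).
have ts0 : 0 < ts by rewrite divr_gt0 ?mulr_gt0.
pose h := (ts - t) / 2; pose t1 := (t + ts) / 2.
have t10 : 0 < t1 by rewrite divr_gt0 ?addr_gt0.
have tsE : p' * B = ts * ((1 - p') * (t + m)).
  by rewrite /ts divfK // gt_eqF // mulr_gt0.
pose D := t * (t + m) + B.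
have D0 : 0 < D by rewrite addr_gt0 // mulr_gt0.
pose s := 2 * (1 - p') * (t + m) / D.
have s0 : 0 < s by rewrite divr_gt0 // !mulr_gt0.
have p'E : p' - p0 = h * s.
  apply: (mulIf (lt0r_neq0 D0)).
  rewrite mulrBl (_ : p0 = t * (t + m) / D) // divfK ?gt_eqF //.
  rewrite -mulrA (_ : s * D = 2 * (1 - p') * (t + m)); last first.
    by rewrite /s divfK ?gt_eqF.
  have -> : p' * D = p' * (t * (t + m)) + p' * B by rewrite /D; ring.
  by rewrite tsE /h; field.
have h0 : h != 0 by move: p'p0; rewrite -subr_eq0 p'E mulf_eq0 negb_or => /andP[].
have hE : h = t1 - t by rewrite /h /t1; field.
have tsh : ts = t1 + h by rewrite /h /t1; field.
clearbody h t1 s.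
pose u := ratea t - ratea t1; pose v := rateb t - rateb t1.
(* Both lower bounds come from [ln (1 + x) <= x], applied to the ratio of the arguments at [t1] and
   [t]. *)
have u_ge : m * h / (t1 * (t + m)) <= u.
  have e1 : 0 < 1 + m / t by apply: addr_gt0; [exact: ltr01 | exact: divr_gt0].
  have e2 : 0 < 1 + m / t1 by apply: addr_gt0; [exact: ltr01 | exact: divr_gt0].
  have := @le_ln1Dx _ ((1 + m / t1) / (1 + m / t) - 1).
  rewrite [1 + (_ - 1)]addrC subrK ln_div ?posrE // -/(ratea t) -/(ratea t1).
  rewrite ltrBDr addNr divr_gt0 // => /(_ isT) le.
  have -> : m * h / (t1 * (t + m)) = - ((1 + m / t1) / (1 + m / t) - 1).
    by rewrite hE; field; rewrite !gt_eqF // addr_gt0.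
  by rewrite /u; lra.
have v_ge : - (m * h / B) <= v.
  have B10 := den_gt0 t1 t10.
  have := @le_ln1Dx _ ((m * t1 + c) / B - 1).
  rewrite [1 + (_ - 1)]addrC subrK ln_div ?posrE // -[ln B]/(rateb t) -/(rateb t1).
  rewrite ltrBDr addNr divr_gt0 // => /(_ isT) le.
  have -> : - (m * h / B) = - ((m * t1 + c) / B - 1).
    by rewrite hE /B; field; rewrite gt_eqF.
  by rewrite /v; lra.
pose d := p' * u + (1 - p') * v.
(* Since [ts - t1 = h], the two bounds combine to a positive multiple of [h^2]. *)
have d0 : 0 < d.
  apply: (@lt_le_trans _ _ (p' * (m * h / (t1 * (t + m))) - (1 - p') * (m * h / B))).
    have -> : p' * (m * h / (t1 * (t + m))) - (1 - p') * (m * h / B)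
       = m * h * (p' * B - (1 - p') * (t1 * (t + m))) / (t1 * (t + m) * B).
      by field; rewrite !gt_eqF.
    rewrite tsE (_ : ts * _ - _ = h * ((1 - p') * (t + m))); last by rewrite tsh; ring.
    rewrite (_ : m * h * _ = h ^+ 2 * (m * ((1 - p') * (t + m)))); last by ring.
    apply: divr_gt0; last by rewrite !mulr_gt0.
    by apply: mulr_gt0; [rewrite exprn_even_gt0 | rewrite !mulr_gt0].
  by rewrite /d -mulrN; apply: lerD; apply: ler_wpM2l => //; exact: ltW.
have mono s1 s2 : 0 < s1 -> s1 <= s2 ->
    ratea s2 <= ratea s1 /\ rateb s1 <= rateb s2.
  move=> s10 s12; have s20 := lt_le_trans s10 s12.
  have h1 : m / s2 <= m / s1 by rewrite ler_pM2l // lef_pV2.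
  split; rewrite ler_ln ?posrE ?den_gt0 ?addr_gt0 ?divr_gt0 //.
    by rewrite lerD2l.
  by rewrite lerD2r ler_pM2l.
(* [ratea] decreases and [rateb] increases, so [u - v] has the sign of [h]: frequencies beyond [p']
   decay at least as fast as [p'] itself. *)
have huv : 0 <= h * (u - v).
  have t1E : t1 = t + h by rewrite hE addrC subrK.
  have [hp|/ltW hn] := lerP 0 h.
    have [|] := mono t t1 t0; first by rewrite t1E lerDl.
    by rewrite /u /v => h1 h2; rewrite mulr_ge0 //; lra.
  have [|] := mono t1 t t10; first by rewrite t1E gerDl.
  by rewrite /u /v => h1 h2; rewrite mulr_le0 //; lra.
have [K K0 fK] := coef_le_expR t1 t10.
exists K, d; split=> // i n lein; rewrite p'E => sgn.
apply: (@le_trans _ _ (K * expR (i%:R * ratea t1 + (n - i)%:R * rateb t1) *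
   expR (- (i%:R * ratea t + (n - i)%:R * rateb t)))).
  by rewrite ler_wpM2r ?expR_ge0.
rewrite -mulrA -expRD ler_pM2l // ler_expR natrB //.
(* The exponent gained is [i u + (n - i) v = n d + (u - v) (i - n p')]. *)
suff : 0 <= (u - v) * (i%:R - n%:R * p').
  by rewrite /d /u /v; nra.
have hh : 0 < h ^+ 2 * s by rewrite mulr_gt0 // exprn_even_gt0.
rewrite -(pmulr_rge0 _ hh).
have -> : h ^+ 2 * s * ((u - v) * (i%:R - n%:R * p')) =
    h * (u - v) * (h * s * (i%:R - n%:R * p')) by ring.
exact: mulr_ge0.
Qed.

(** The [p] for which [t] is the critical point of [p * ratea t + (1 - p) * rateb t]. *)
Definition freq (t : R) : R := t * (t + m) / (t * (t + m) + (m * t + c)).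

Lemma freq_bounds (t : R) : 0 < t -> 0 < freq t < 1.
Proof.
move=> t0; have B0 := den_gt0 t t0.
have A0 : 0 < t * (t + m) by rewrite mulr_gt0 // addr_gt0.
have D0 := addr_gt0 A0 B0.
by rewrite /freq divr_gt0 //= ltr_pdivrMr // mul1r ltrDl.
Qed.

Lemma tau_ge_family (t : R) (C : set (R * R)) : 0 < t -> open_cone C ->
  C (t * (t + m), m * t + c) ->
  let p := t * (t + m) / (t * (t + m) + (m * t + c)) in
  ((p * ratea t + (1 - p) * rateb t)%:E <= tau f C)%E.
Proof.
move=> t0 [Copen Ccone] Ct; rewrite -/(freq t); have /andP[p0 p1] := freq_bounds t t0.
have B0 := den_gt0 t t0.
have A0 : 0 < t * (t + m) by rewrite mulr_gt0 // addr_gt0.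
have Cp : C (freq t, 1 - freq t).
  have D0 : 0 < t * (t + m) + (m * t + c) by rewrite addr_gt0.
  have := Ccone _ Ct (t * (t + m) + (m * t + c))^-1; rewrite invr_gt0 => /(_ D0) /=.
  rewrite [X in C (X, _)]mulrC -/(freq t).
  congr (C (_, _)); rewrite /freq; field; exact: lt0r_neq0.
have := coef_weight_off_freq_le t; rewrite /= -/(freq t).
have [k [K0 [k0 fk]]] := f_bounds t t0.
set p := freq t in p0 p1 Cp * => off; clearbody p.
have q0 : 0 < 1 - p by rewrite subr_gt0.
set a := ratea t in off *; set b := rateb t in off *.
apply/lee_subgt0Pr => e e0; rewrite -EFinD; apply: tau_ge => M.
have [d /= d0 dC] : exists2 d : R, 0 < d & forall x, `|x - p| < d -> C (x, 1 - x).
  have /nbhs_ballP[d /= d0 dC] : nbhs (p, 1 - p) C by apply: open_nbhs_nbhs.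
  exists d => // x xp; apply: dC; split=> /=; rewrite -ball_normE /=.
    by rewrite distrC.
  by rewrite (_ : 1 - p - (1 - x) = x - p) //; ring.
(* The four bounds keep nearby directions in [C], keep their rate within [e / 2] of the target, and
   keep [p + r] and [p - r] strictly between 0 and 1. *)
pose r := Num.min (Num.min (d / 2) (e / (2 * (1 + `|a - b|))))
  (Num.min (p / 2) ((1 - p) / 2)).
have ab0 : 0 < 1 + `|a - b| by rewrite ltr_pwDl.
have r0 : 0 < r.
  by rewrite !lt_min !divr_gt0 // mulr_gt0.
have [rd [re [rp rq]]] : r <= d / 2 /\ r <= e / (2 * (1 + `|a - b|)) /\
    r <= p / 2 /\ r <= (1 - p) / 2.
  by rewrite /r !ge_min !lexx ?orbT.
clearbody r.
have [||K1 [d1 [K10 d10 off1]]] := off (p + r) t0.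
- by apply/andP; split; lra.
- by rewrite -subr_eq0 addrC addKr gt_eqF.
have [||K2 [d2 [K20 d20 off2]]] := off (p - r) t0.
- by apply/andP; split; lra.
- by rewrite -subr_eq0 addrAC subrr add0r oppr_eq0 gt_eqF.
have k40 : 0 < k / 4 by rewrite divr_gt0.
have [M1 HM1] := @expR_decay _ K1 d1 (k / 4) K10 d10 k40.
have [M2 HM2] := @expR_decay _ K2 d2 (k / 4) K20 d20 k40.
(* Beyond [M1] and [M2] the two tails of the frequency weigh at most [k / 4] each; beyond [M3] the
   constant [k / 2] costs less than [e / 2] in the rate. *)
pose M3 := - ln (k / 2) / (e / 2).
pose n := (Num.truncn (Num.max (Num.max (Num.max 0 M) M1) (Num.max M2 M3))).+1.
have : Num.max (Num.max (Num.max 0 M) M1) (Num.max M2 M3) < n%:R by exact: truncnS_gt.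
rewrite !gt_max => /andP[/andP[/andP[n0 nM] nM1] /andP[nM2 nM3]].
clearbody n; exists n%:R => //.
set L := p * a + (1 - p) * b.
have shell_ge : k / 2 * expR (n%:R * (L - e / 2)) <= shell_sum f C n%:R.
  apply: (le_trans _ (@shell_sum_ge_diag _ f f_ge0 C n)).
  set S := \sum_(i < n.+1 | _) _.
  pose Bn := K1 * expR (- (n%:R * d1)) + K2 * expR (- (n%:R * d2)).
  have Bn0 : 0 <= Bn by rewrite addr_ge0 // mulr_ge0 ?expR_ge0 ?ltW.
  have /andP[kS _] := fk n.
  suff : k <= expR (- (n%:R * (L - e / 2))) * S + n.+1%:R * Bn.
    have : n.+1%:R * Bn <= k / 2.
      rewrite mulrDr; have := HM1 _ nM1; have := HM2 _ nM2; lra.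
    move=> h1 h2; rewrite -ler_pdivlMr ?expR_gt0 // -expRN mulrC; lra.
  apply: (le_trans kS); rewrite /S big_distrr /= [X in _ <= X + _]big_mkcond /=.
  have -> : n.+1%:R * Bn = \sum_(i < n.+1) Bn.
    by rewrite sumr_const card_ord mulr_natl.
  rewrite -big_split /=.
  (* Each index is either at frequency distance at least [r] from [p], where [Bn] bounds its term,
     or close to [p], hence in [C] and counted in [S]. *)
  apply: ler_sum => i _; rewrite weight_expR // -/a -/b.
  have lein : (i <= n)%N by rewrite -ltnS.
  have [far1|near1] := lerP (n%:R * (p + r)) i%:R.
    have := off1 i n lein; rewrite -/a -/b addrAC subrr add0r.
    rewrite mulr_ge0 ?subr_ge0 ?(ltW r0) // => /(_ isT) h.
    apply: ler_wpDl; last by apply: (le_trans h); rewrite lerDl mulr_ge0 ?expR_ge0 ?ltW.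
    by case: ifP => _ //; rewrite mulr_ge0 ?expR_ge0.
  have [far2|near2] := lerP i%:R (n%:R * (p - r)).
    have := off2 i n lein; rewrite -/a -/b addrAC subrr add0r mulNr -mulrN opprB.
    rewrite mulr_ge0 ?subr_ge0 ?(ltW r0) // => /(_ isT) h.
    apply: ler_wpDl; last by apply: (le_trans h); rewrite lerDr mulr_ge0 ?expR_ge0 ?ltW.
    by case: ifP => _ //; rewrite mulr_ge0 ?expR_ge0.
  pose x : R := i%:R / n%:R.
  have iE : i%:R = n%:R * x :> R by rewrite /x mulrC divfK // gt_eqF.
  have jE : (n - i)%:R = n%:R * (1 - x) :> R by rewrite natrB // iE; ring.
  have xp : `|x - p| < r.
    rewrite ltr_norml; move: near1 near2; rewrite iE !ltr_pM2l //; lra.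
  rewrite ifT; last first.
    apply/asboolP; rewrite iE jE; apply: (Ccone (x, 1 - x)) => //; apply: dC; lra.
  apply: ler_wpDr => //; rewrite mulrC ler_wpM2r // ler_expR lerN2 iE jE.
  have -> : n%:R * x * a + n%:R * (1 - x) * b = n%:R * (L + (x - p) * (a - b)).
    by rewrite /L; ring.
  rewrite ler_pM2l // lerD2l.
  have : `|(x - p) * (a - b)| <= e / 2.
    rewrite normrM; apply: (@le_trans _ _ (r * (1 + `|a - b|))).
      by apply: ler_pM => //; [exact: ltW | rewrite lerDr].
    rewrite -ler_pdivlMr //; apply: (le_trans re).
    by rewrite invfM mulrA.
  by rewrite ler_norml => /andP[].
have sh0 : 0 < shell_sum f C n%:R.
  by apply: lt_le_trans shell_ge; rewrite mulr_gt0 ?expR_gt0 ?divr_gt0.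
rewrite /shell_rate gt_eqF // lee_fin ler_pdivlMr //.
have k20 : 0 < k / 2 by rewrite divr_gt0.
apply: (@le_trans _ _ (ln (k / 2 * expR (n%:R * (L - e / 2))))); last first.
  by rewrite ler_ln ?posrE // mulr_gt0 ?expR_gt0.
rewrite lnM ?posrE ?expR_gt0 // expRK.
have : - ln (k / 2) < n%:R * (e / 2) by rewrite -ltr_pdivrMr // divr_gt0.
lra.
Qed.

Lemma indicatriceE (p q : R) : 0 <= p -> 0 <= q -> p + q = 1 ->
  indicatrice f (p, q) =
  ereal_inf [set tau f C | C in [set C | open_cone C /\ C (p, q)]].
Proof.
move=> p0 q0 pq; rewrite /indicatrice /= !ger0_norm // pq mul1e ifF //.
apply/negP => /eqP [pE qE]; move: pq; rewrite pE qE addr0 => /eqP.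
by rewrite eq_sym oner_eq0.
Qed.

Lemma indicatrice_le (t p q : R) : 0 < t -> 0 <= p -> 0 <= q -> p + q = 1 ->
  (indicatrice f (p, q) <= (p * ratea t + q * rateb t)%:E)%E.
Proof. by move=> t0 p0 q0 pq; rewrite indicatriceE //; exact: inf_tau_le. Qed.

(** The last hypothesis says [p = freq t], so the upper bound at [t] meets the lower bound in the
    direction of [t]. *)
Lemma indicatrice_eq (t p q : R) : 0 < t -> 0 <= p -> 0 <= q -> p + q = 1 ->
  p * (m * t + c) = q * (t * (t + m)) ->
  indicatrice f (p, q) = (p * ratea t + q * rateb t)%:E.
Proof.
move=> t0 p0 q0 pq bal; apply/le_anti; rewrite indicatrice_le //=.
have B0 := den_gt0 t t0.
have A0 : 0 < t * (t + m) by rewrite mulr_gt0 // addr_gt0.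
have D0 := addr_gt0 A0 B0.
have pE : p * (t * (t + m) + (m * t + c)) = t * (t + m).
  by rewrite mulrDr bal -mulrDl pq mul1r.
have qE : q * (t * (t + m) + (m * t + c)) = m * t + c.
  by rewrite mulrDr -bal -mulrDl pq mul1r.
rewrite indicatriceE //; apply: le_ereal_inf_tmp => _ [C [[Co Cc] Cpq] <-].
have Ct : C (t * (t + m), m * t + c).
  by have := Cc _ Cpq _ D0; rewrite /= ![_ * p]mulrC ![_ * q]mulrC pE qE.
have := tau_ge_family t C t0 (conj Co Cc) Ct.
have -> : t * (t + m) / (t * (t + m) + (m * t + c)) = p.
  by rewrite -[X in X / _]pE mulfK // gt_eqF.
by rewrite /= (_ : 1 - p = q) // -pq addrAC subrr add0r.
Qed.

(* Upper semicontinuity at a boundary direction: a cone around [(p, q)] also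
   contains nearby directions of the family. *)
Lemma indicatrice_ge0 (p q : R) : 0 <= p -> 0 <= q -> p + q = 1 ->
  (forall t : R, 0 < t -> 0 <= (t * (t + m)) * ratea t + (m * t + c) * rateb t) ->
  (forall d : R, 0 < d -> exists2 t : R, 0 < t &
     `|t * (t + m) / (t * (t + m) + (m * t + c)) - p| < d) ->
  (0 <= indicatrice f (p, q))%E.
Proof.
move=> p0 q0 pq rate0 near.
rewrite indicatriceE //; apply: le_ereal_inf_tmp => _ [C [[Co Cc] Cpq] <-].
have /nbhs_ballP[d /= d0 dC] : nbhs (p, q) C by apply: open_nbhs_nbhs.
have [t t0] := near d d0.
have B0 := den_gt0 t t0.
have A0 : 0 < t * (t + m) by rewrite mulr_gt0 // addr_gt0.
have D0 := addr_gt0 A0 B0.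
set D := t * (t + m) + (m * t + c) in D0 * => close.
have qE : 1 - t * (t + m) / D = (m * t + c) / D.
  by rewrite -[1](@divff _ D) ?gt_eqF // -mulrBl /D addrAC subrr add0r.
have Ct : C (t * (t + m), m * t + c).
  have : C (t * (t + m) / D, 1 - t * (t + m) / D).
    apply: dC; split => /=; rewrite -ball_normE /=; first by rewrite distrC.
    have -> : q - (1 - t * (t + m) / D) = t * (t + m) / D - p by rewrite -pq; ring.
    exact: close.
  move=> /Cc /(_ D D0) /=; rewrite qE [D * _]mulrC divfK ?gt_eqF //.
  by rewrite [D * _]mulrC divfK ?gt_eqF.
apply: le_trans (tau_ge_family t C t0 (conj Co Cc) Ct); rewrite -/D qE lee_fin.
have -> : t * (t + m) / D * ratea t + (m * t + c) / D * rateb t =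
   (t * (t + m) * ratea t + (m * t + c) * rateb t) / D by field; rewrite gt_eqF.
by rewrite divr_ge0 ?rate0 // ltW.
Qed.

End Family.

(** * The two languages as instances of the family *)

(* The comprehension in [coefF2] is a classical set, the one in [word_coef] a
   [{set _}]; hence the lemma is not a conversion. *)
Lemma coefF2E (R : realType) :
  @coefF2 R = word_coef R letter
    (fun u v : letter => ~~ ((u.1 == v.1) && (u.2 != v.2))) fst.
Proof.
apply/funext => i; apply/funext => j; congr _%:R; apply: eq_card => t.
by rewrite [RHS]inE; apply/idP/idP; rewrite in_setE.
Qed.

Lemma coefF2_ge0 (R : realType) (i j : nat) : 0 <= coefF2 R i j.
Proof. exact: ler0n. Qed.

(** Only the inverse of the preceding letter is forbidden: one letter of the same type and two of
    the other may follow, so [m = 2] and [c = 1]. *)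
Lemma coefF2_bounds (R : realType) (t : R) : 0 < t ->
  exists k K : R, 0 < k /\ forall n,
  k <= \sum_(i < n.+1) coefF2 R i (n - i) *
         ((t / (t + 2)) ^+ i * (2 * t + 1)^-1 ^+ (n - i)) <= K.
Proof.
move=> t0; rewrite coefF2E.
apply: (@word_coef_bounds R letter _ _ 2 1 t (false, false)) => // u.
set ok := (X in \sum_(v | X v) _).
rewrite big_mkcond -(pair_bigA _ (fun i j =>
    if ok (i, j) then if i then 1 else t else 0)) /= !big_bool /ok.
by case: u {ok} => [[] []] /=; lra.
Qed.

Lemma coefFibE (R : realType) :
  @coefFib R = word_coef R bool (fun u v : bool => ~~ (u && v)) id.
Proof.
apply/funext => i; apply/funext => j; congr _%:R; apply: eq_card => t.
by rewrite [RHS]inE; apply/idP/idP; rewrite in_setE.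
Qed.

Lemma coefFib_ge0 (R : realType) (i j : nat) : 0 <= coefFib R i j.
Proof. exact: ler0n. Qed.

(** After [a] both letters may follow, after [b] only [a]: [m = 1] and [c = 0]. *)
Lemma coefFib_bounds (R : realType) (t : R) : 0 < t ->
  exists k K : R, 0 < k /\ forall n,
  k <= \sum_(i < n.+1) coefFib R i (n - i) *
         ((t / (t + 1)) ^+ i * (1 * t + 0)^-1 ^+ (n - i)) <= K.
Proof.
move=> t0; rewrite coefFibE.
apply: (@word_coef_bounds R bool _ _ 1 0 t false) => // u.
by rewrite big_mkcond /= big_bool; case: u => /=; lra.
Qed.

(** * The indicatrice of the free group *)

Lemma indicatrice_F2_interior (R : realType) (p q : R) :
  0 < p -> 0 < q -> p + q = 1 ->
  indicatrice (@coefF2 R) (p, q) =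
  (entropy (p, q)
   + p * ln (2 * q - p + 2 * Num.sqrt (p ^+ 2 - p * q + q ^+ 2))
   + q * ln (2 * p - q + 2 * Num.sqrt (p ^+ 2 - p * q + q ^+ 2)))%:E.
Proof.
move=> p0 q0 pq; set s := Num.sqrt _.
have s0 : 0 <= s by exact: sqrtr_ge0.
have sE : s ^+ 2 = p ^+ 2 - p * q + q ^+ 2.
  rewrite sqr_sqrtr // (_ : _ + _ = (p - q) ^+ 2 + p * q); last by ring.
  by rewrite addr_ge0 ?sqr_ge0 // ltW // mulr_gt0.
clearbody s.
have pq0 := mulr_gt0 p0 q0.
have s_gt : p - q < s by rewrite ltNge; apply/negP => h; have := ler_pM s0 s0 h h; lra.
have s_gt' : q - p < s by rewrite ltNge; apply/negP => h; have := ler_pM s0 s0 h h; lra.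
have e0 : 0 < q - p + s by lra.
(* The positive root of [q t^2 + 2 (q - p) t - p = 0]. Of its two conjugate forms, this one puts
   [1 + 2 / t] over [p] and the next puts [2 t + 1] over [q]; these denominators produce the
   entropy. *)
pose t := p / (q - p + s); have t0 : 0 < t by rewrite divr_gt0.
have tq : t = (p - q + s) / q.
  apply/eqP; rewrite /t eqr_div ?lt0r_neq0 //; apply/eqP.
  have -> : (p - q + s) * (q - p + s) = s ^+ 2 - (p - q) ^+ 2 by ring.
  by rewrite sE; ring.
have bal : p * (2 * t + 1) = q * (t * (t + 2)).
  have qE : q * t = p - q + s by rewrite tq mulrC divfK // gt_eqF.
  have pE : p = t * (q - p + s) by rewrite /t divfK // gt_eqF.
  clearbody t; nra.
rewrite (@indicatrice_eq R 2 1 (@coefF2 R) _ _ (@coefF2_ge0 R)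
  (@coefF2_bounds R) t) //; try exact: ltW.
congr _%:E; rewrite /entropy /plogp /= !gt_eqF // /ratea /rateb.
have -> : 1 + 2 / t = (2 * q - p + 2 * s) / p.
  by rewrite /t; field; rewrite !gt_eqF.
have -> : 2 * t + 1 = (2 * p - q + 2 * s) / q.
  by rewrite tq; field; rewrite gt_eqF.
rewrite !ln_div ?posrE //; try lra.
Qed.

Lemma indicatrice_F2_edge (R : realType) (p q : R) :
  p + q = 1 -> p = 0 \/ q = 0 -> indicatrice (@coefF2 R) (p, q) = 0%E.
Proof.
move=> pq edge.
have [p0 q0] : 0 <= p /\ 0 <= q by case: edge => h; move: pq; rewrite h; lra.
have lnge0 (x : R) : 0 <= x -> 0 <= ln (1 + x) :> R.
  by move=> x0; rewrite ln_ge0 // lerDl.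
apply/le_anti/andP; split.
  apply/lee_addgt0Pr => e e0; rewrite add0e.
  (* With [ln (1 + x) <= x], the remaining rate is at most [2 t = e] if [p = 0], and at most
     [2 / t = e] if [q = 0]. *)
  pose t := if p == 0 then e / 2 else 2 / e.
  have t0 : 0 < t by rewrite /t; case: ifP => _; rewrite divr_gt0.
  apply: (le_trans (@indicatrice_le R 2 1 (@coefF2 R) _ _ (@coefF2_ge0 R)
    (@coefF2_bounds R) t p q _ _ _ _)) => //.
  rewrite lee_fin /ratea /rateb /t; move: pq; case: edge => ->.
    rewrite add0r eqxx => ->; rewrite mul0r add0r mul1r mulrC divfK //.
    by rewrite addrC le_ln1Dx //; lra.
  rewrite addr0 => ->; rewrite oner_eq0 mul0r addr0 mul1r invf_div mulrC divfK //.
  by rewrite le_ln1Dx //; lra.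
apply: (@indicatrice_ge0 R 2 1 (@coefF2 R) _ _ (@coefF2_ge0 R)
    (@coefF2_bounds R) p q) => //.
  move=> t t0; have A0 : 0 <= t * (t + 2) by rewrite mulr_ge0; lra.
  apply: addr_ge0; apply: mulr_ge0 => //; first by rewrite lnge0 // divr_ge0 // ltW.
    lra.
  by rewrite /rateb addrC lnge0; lra.
move=> d d0; move: pq; case: edge => ->.
  (* For [t <= 1] the numerator [t (t + 2)] is at most [3 t < d], and the denominator exceeds 1. *)
  exists (Num.min 1 (d / 4)); first by rewrite lt_min ltr01 divr_gt0.
  set t := Num.min _ _.
  have [t0 [t1 td]] : 0 < t /\ t <= 1 /\ t <= d / 4.
    by rewrite /t lt_min ltr01 divr_gt0 // !ge_min !lexx orbT.
  clearbody t; have A0 : 0 < t * (t + 2) by rewrite mulr_gt0 // addr_gt0.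
  have D0 : 0 < t * (t + 2) + (2 * t + 1) by lra.
  rewrite subr0 ger0_norm; last by rewrite divr_ge0 // ltW.
  rewrite ltr_pdivrMr //; nra.
rewrite addr0 => ->; have t0 : 0 < 3 / d by rewrite divr_gt0.
exists (3 / d) => //; set t := 3 / d in t0 *.
have dt : d * t = 3 by rewrite /t mulrC divfK // gt_eqF.
clearbody t; have A0 : 0 < t * (t + 2) by rewrite mulr_gt0 // addr_gt0.
have D0 : 0 < t * (t + 2) + (2 * t + 1) by lra.
have -> : t * (t + 2) / (t * (t + 2) + (2 * t + 1)) - 1 =
  - ((2 * t + 1) / (t * (t + 2) + (2 * t + 1))) by field; rewrite gt_eqF.
rewrite normrN ger0_norm; last by rewrite divr_ge0 //; lra.
rewrite ltr_pdivrMr //.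
have -> : d * (t * (t + 2) + (2 * t + 1)) = d * t * (t + 4) + d by ring.
rewrite dt; lra.
Qed.

(** * The indicatrice of the Fibonacci language *)

Lemma indicatrice_Fib_interior (R : realType) (p q : R) :
  0 < q -> q < p -> p + q = 1 ->
  indicatrice (@coefFib R) (p, q) =
  (p * ln (p / (p - q)) + q * ln ((p - q) / q))%:E.
Proof.
move=> q0 qp pq; have e0 : 0 < p - q by rewrite subr_gt0.
have t0 : 0 < (p - q) / q by rewrite divr_gt0.
have bal : p * (1 * ((p - q) / q) + 0) =
    q * ((p - q) / q * ((p - q) / q + 1)) by field; rewrite gt_eqF.
have p0 : 0 <= p by lra.
rewrite (@indicatrice_eq R 1 0 (@coefFib R) _ _ (@coefFib_ge0 R)
  (@coefFib_bounds R) ((p - q) / q)) //; last exact: ltW.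
rewrite /ratea /rateb !mul1r addr0; congr (_ * ln _ + _)%:E.
by field; rewrite !gt_eqF.
Qed.

Lemma indicatrice_Fib_half (R : realType) :
  indicatrice (@coefFib R) (2^-1, 2^-1) = 0%E.
Proof.
have pq : 2^-1 + 2^-1 = 1 :> R by lra.
have h0 : 0 <= 2^-1 :> R by lra.
apply/le_anti/andP; split.
  apply/lee_addgt0Pr => e e0; rewrite add0e.
  apply: (le_trans (@indicatrice_le R 1 0 (@coefFib R) _ _ (@coefFib_ge0 R)
    (@coefFib_bounds R) e _ _ _ _ _ _)) => //.
  (* The rate at parameter [e] is [ln (1 + e) / 2], which tends to 0 with [e]. *)
  rewrite lee_fin /ratea /rateb !mul1r addr0 -mulrDr -lnM ?posrE //; last first.
    by rewrite addr_gt0 // invr_gt0.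
  rewrite mulrDl mulVf ?gt_eqF // mul1r addrC.
  have : ln (1 + e) <= e by rewrite le_ln1Dx //; lra.
  lra.
apply: (@indicatrice_ge0 R 1 0 (@coefFib R) _ _ (@coefFib_ge0 R)
    (@coefFib_bounds R)) => //.
  move=> t t0; have i0 : 0 < t^-1 by rewrite invr_gt0.
  have A0 : 0 <= ratea R 1 t by rewrite /ratea mul1r ln_ge0 // lerDl ltW.
  have B0 : 0 <= ln (1 + t) by rewrite ln_ge0 // lerDl ltW.
  (* [rateb] is [ln t], negative for [t < 1]; written this way, its negative part is absorbed by the
     [ratea] term. *)
  have -> : rateb R 1 0 t = ln (1 + t) - ratea R 1 t.
    have t10 : 0 < 1 + t^-1 by rewrite addr_gt0.
    have -> : 1 + t = t * (1 + t^-1) by rewrite mulrDr mulr1 mulfV ?gt_eqF // addrC.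
    by rewrite lnM ?posrE // /ratea /rateb !mul1r addr0 addrK.
  rewrite mul1r addr0.
  have -> : t * (t + 1) * ratea R 1 t + t * (ln (1 + t) - ratea R 1 t) =
    t * t * ratea R 1 t + t * ln (1 + t) by ring.
  by rewrite addr_ge0 // !mulr_ge0 // ltW.
move=> d d0; exists d => //.
have -> : d * (d + 1) / (d * (d + 1) + (1 * d + 0)) - 2^-1 = d / (2 * (d + 2)).
  by field; rewrite !gt_eqF ?addr_gt0 ?mulr_gt0 ?addr_gt0.
have D0 : 0 < 2 * (d + 2) by lra.
rewrite ger0_norm; last by rewrite divr_ge0 // ltW.
by rewrite ltr_pdivrMr //; nra.
Qed.

Lemma indicatrice_Fib_empty (R : realType) (p q : R) :
  0 < p -> p < q -> p + q = 1 -> indicatrice (@coefFib R) (p, q) = -oo%E.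
Proof.
move=> p0 pq pq1; apply: eq_ninfty => r.
have q0 := lt_trans p0 pq; have qp0 : 0 < q - p by rewrite subr_gt0.
(* With [ln t = - M] the upper bound is [p ln (1 + t) - (q - p) M <= 1 - |1 - r| <= r]. *)
pose M := `|1 - r| / (q - p); have M0 : 0 <= M by rewrite divr_ge0 // ltW.
pose t := expR (- M); have t0 : 0 < t by exact: expR_gt0.
have t1 : t <= 1 by rewrite expR_le1 oppr_le0.
apply: (le_trans (@indicatrice_le R 1 0 (@coefFib R) _ _ (@coefFib_ge0 R)
    (@coefFib_bounds R) t _ _ _ _ _ _)) => //; try exact: ltW.
rewrite lee_fin.
have lt : rateb R 1 0 t = - M by rewrite /rateb mul1r addr0 expRK.
have -> : ratea R 1 t = ln (1 + t) + M.
  rewrite /ratea mul1r -[M]opprK -lt /rateb mul1r addr0 -ln_div ?posrE ?addr_gt0 //.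
  by congr ln; field; rewrite gt_eqF.
have : ln (1 + t) <= 1 by apply: le_trans t1; rewrite le_ln1Dx //; lra.
rewrite lt => l1; have : p * ln (1 + t) <= p * 1 by rewrite ler_pM2l.
have : (q - p) * M = `|1 - r| by rewrite /M mulrC divfK // gt_eqF.
have := ler_norm (1 - r); lra.
Qed.

Theorem theorem1 (R : realType) :
  (forall p q : R, 0 <= p -> 0 <= q -> p + q = 1 ->
     indicatrice (@coefF2 R) (p, q) =
     (entropy (p, q)
      + p * ln (2 * q - p + 2 * Num.sqrt (p ^+ 2 - p * q + q ^+ 2))
      + q * ln (2 * p - q + 2 * Num.sqrt (p ^+ 2 - p * q + q ^+ 2)))%:E)
  /\
  (forall p : R, 0 < p < 1 ->
     let q := 1 - p in
     indicatrice (@coefFib R) (p, q) =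
     (if 2^-1 <= p then (p * ln (p / (p - q)) + q * ln ((p - q) / q))%:E
      else -oo%E)).
Proof.
split=> [p q p0 q0 pq|p /andP[p0 p1] q].
  have [pz|pn0] := eqVneq p 0.
    have q1 : q = 1 by rewrite -pq pz add0r.
    rewrite indicatrice_F2_edge //; last by left.
    rewrite pz q1 (_ : 0 ^+ 2 - 0 * 1 + 1 ^+ 2 = 1 :> R); last by ring.
    rewrite sqrtr1 (_ : 2 * 0 - 1 + 2 * 1 = 1 :> R); last by ring.
    by rewrite /entropy /plogp /= eqxx oner_eq0 ln1; congr _%:E; ring.
  have [qz|qn0] := eqVneq q 0.
    have p1 : p = 1 by rewrite -pq qz addr0.
    rewrite indicatrice_F2_edge //; last by right.
    rewrite qz p1 (_ : 1 ^+ 2 - 1 * 0 + 0 ^+ 2 = 1 :> R); last by ring.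
    rewrite sqrtr1 (_ : 2 * 0 - 1 + 2 * 1 = 1 :> R); last by ring.
    by rewrite /entropy /plogp /= eqxx oner_eq0 ln1; congr _%:E; ring.
  by apply: indicatrice_F2_interior => //; rewrite lt0r ?pn0 ?qn0.
have q0 : 0 < q by rewrite subr_gt0.
have pq : p + q = 1 by rewrite addrC subrK.
clearbody q; case: ifPn => [hp|]; last first.
  by rewrite -ltNge => hp; apply: indicatrice_Fib_empty => //; lra.
have [qp|pq'] := ltP q p; first exact: indicatrice_Fib_interior.
have -> : p = 2^-1 by lra.
have -> : q = 2^-1 by lra.
(* At [p = q] the formula is read with [x / 0 = 0] and [ln 0 = 0], so both its terms vanish. *)
by rewrite indicatrice_Fib_half subrr invr0 mulr0 mul0r ln0 // mulr0 addr0.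
Qed.
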